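(* Assume the continuum hypothesis $\mathsf{CH}$. There exists a Cantor intersection functional $\Phi_0$ that is countably based. Hence $\Phi_0+\exists^2$ cannot compute $\Omega_C$.
   Context: Computability is Kleene's higher-order computability (S1–S9), extended to partial functionals. $\exists^2:\mathbb{N}^{\mathbb{N}}\to\{0,1\}$ satisfies $\exists^2(g)=0\leftrightarrow(\exists n)(g(n)=0)$. Sets are given by characteristic functions. $\Omega_C$ is defined exactly on closed $X\subseteq2^{\mathbb{N}}$, with value $0$ if $X=\emptyset$ and $1$ otherwise. A Cantor intersection functional is any $\Phi$ such that for every sequence $(C_n)$ of non-empty closed sets with $C_{n+1}\subseteq C_n\subseteq[0,1]$, $\Phi(\lambda n.C_n)\in\bigcap_nC_n$. A partial functional $\Phi$ of type $\tau_1,\dots,\tau_n\to0$, where $\tau_i=\delta_{i,1},\dots,\delta_{i,m_i}\to0$ and each $\delta_{i,j}$ has rank 1, is countably based if whenever $\Phi(F_1,\dots,F_n)\in\mathbb{N}$ there are countable sets $X_i$ of tuples of type $\delta_{i,1}\times\cdots\times\delta_{i,m_i}$ such that $\Phi(F_1,\dots,F_n)=\Phi(G_1,\dots,G_n)$ whenever $\Phi(G_1,\dots,G_n)\in\mathbb{N}$ and $F_i,G_i$ agree on $X_i$ for each $i$. *)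

(* Defs.v *)
From HB Require Import structures.
From mathcomp Require Import all_boot all_order all_algebra.
From mathcomp Require Import all_classical all_reals all_analysis.
Set Implicit Arguments.
Unset Strict Implicit.
Unset Printing Implicit Defensive.
Import Order.TTheory GRing.Theory Num.Theory.
Import numFieldNormedType.Exports.

(** * Finite types and functionals *)

(* [Arr [:: s1; ...; sk]] is the type s1, ..., sk -> 0, so [Arr [::]] is the
   type 0 of the natural numbers. *)
Inductive ftype : Type := Arr of seq ftype.

Definition ty0 : ftype := Arr [::].
Definition ty1 : ftype := Arr [:: ty0].
Definition ty2 : ftype := Arr [:: ty1].

(* Total objects: the full set-theoretic type structure over nat, curried. *)
Fixpoint tot (s : ftype) : Type :=
  match s with Arr ts => foldr (fun t A => tot t -> A) nat ts end.

Definition funs (A : Type) (ts : seq ftype) : Type :=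
  foldr (fun t B => tot t -> B) A ts.

(* Partial functionals of type ts -> 0: their arguments are total objects, and
   [None] stands for "undefined". *)
Definition part (ts : seq ftype) : Type := funs (option nat) ts.

Fixpoint args (ts : seq ftype) : Type :=
  match ts with [::] => unit | t :: ts' => (tot t * args ts')%type end.

Fixpoint papp (A : Type) (ts : seq ftype) : funs A ts -> args ts -> A :=
  match ts return funs A ts -> args ts -> A with
  | [::] => fun a _ => a
  | t :: ts' => fun F x => papp (ts := ts') (F x.1) x.2
  end.

Fixpoint total_part (ts : seq ftype) : funs nat ts -> part ts :=
  match ts return funs nat ts -> part ts with
  | [::] => fun n => Some n
  | t :: ts' => fun F x => total_part (ts := ts') (F x)
  end.

(** * Kleene computability (S1-S9) with partial inputs *)

(* An input of arbitrary finite type.  Numbers and total functionals are the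
   inputs [Inp (total_part F)]. *)
Record input : Type := Inp { input_dom : seq ftype; input_val : part input_dom }.

Definition num_input (n : nat) : input := Inp (input_dom := [::]) (Some n).

Definition total_input (s : ftype) : tot s -> input :=
  match s return tot s -> input with Arr ts => fun F => Inp (total_part (ts := ts) F) end.

Fixpoint inputs (ts : seq ftype) : args ts -> seq input :=
  match ts return args ts -> seq input with
  | [::] => fun _ => [::]
  | t :: ts' => fun x => total_input x.1 :: inputs (ts := ts') x.2
  end.

Notation idx := CodeSeq.code.

(* [kleene e b y] is {e}(b) = y, for a numerical index e.
   S6 moves the k-th argument to the front.
   S8 applies a (possibly partial) input phi of type ts -> 0 to the objects
   lambda xi. {d_i}(xi, phi, b), one index d_i for each type in ts; these
   objects have to be total, and phi has to be defined on them.  Where a type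
   in ts is 0, xi is empty and the object is the number {d_i}(phi, b). *)
Inductive kleene : nat -> seq input -> nat -> Prop :=
| S1 x b : kleene (idx [:: 1]) (num_input x :: b) x.+1
| S2 q b : kleene (idx [:: 2; q]) b q
| S3 x b : kleene (idx [:: 3]) (num_input x :: b) x
| S4 g h b x y :
    kleene h b x -> kleene g (num_input x :: b) y ->
    kleene (idx [:: 4; g; h]) b y
| S5_0 g h b y :
    kleene g b y -> kleene (idx [:: 5; g; h]) (num_input 0 :: b) y
| S5_S g h n b z y :
    kleene (idx [:: 5; g; h]) (num_input n :: b) z ->
    kleene h (num_input n :: num_input z :: b) y ->
    kleene (idx [:: 5; g; h]) (num_input n.+1 :: b) y
| S6 k g a b c y :
    size b = k -> kleene g (a :: b ++ c) y ->
    kleene (idx [:: 6; k; g]) (b ++ a :: c) y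
| S7 (f : part [:: ty0]) x b y :
    f x = Some y -> kleene (idx [:: 7]) (Inp (input_dom := [:: ty0]) f :: num_input x :: b) y
| S8 ts (phi : part ts) ds b (F : args ts) y :
    kleene_args ds (Inp phi :: b) F -> papp phi F = Some y ->
    kleene (idx (8 :: ds)) (Inp phi :: b) y
| S9 m e b c y :
    size b = m -> kleene e b y -> kleene (idx [:: 9; m]) (num_input e :: b ++ c) y
with kleene_args : forall ts : seq ftype, seq nat -> seq input -> args ts -> Prop :=
| kleene_args_nil b : @kleene_args [::] [::] b tt
| kleene_args_cons us ts d ds b (F : tot (Arr us)) (G : args ts) :
    (forall xi : args us,
       kleene d (inputs xi ++ b) (papp (A := nat) (ts := us) F xi)) ->
    kleene_args ds b G ->
    @kleene_args (Arr us :: ts) (d :: ds) b (F, G).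

(* The partial functional Psi is computable in the functionals [os].  The
   index has to give the value of Psi wherever Psi is defined; nothing is asked
   outside the domain of Psi, so that the negation is as strong as possible. *)
Definition computes (os : seq input) (ts : seq ftype) (Psi : part ts) : Prop :=
  exists e : nat, forall (F : args ts) (y : nat),
    papp Psi F = Some y -> kleene e (inputs F ++ os) y.

Definition exists2_functional : tot ty2 :=
  fun g : nat -> nat => if `[< exists n, g n = 0 >] then 0 else 1.

(** * Countably based functionals *)

(* For each argument type Arr ds in ts, a set of tuples of type ds. *)
Fixpoint bases (ts : seq ftype) : Type :=
  match ts with
  | [::] => unit
  | Arr ds :: ts' => (set (args ds) * bases ts')%type
  end.

Fixpoint countable_bases (ts : seq ftype) : bases ts -> Prop :=
  match ts return bases ts -> Prop with
  | [::] => fun _ => True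
  | Arr ds :: ts' => fun X => countable X.1 /\ countable_bases (ts := ts') X.2
  end.

Fixpoint agree_on (ts : seq ftype) : bases ts -> args ts -> args ts -> Prop :=
  match ts return bases ts -> args ts -> args ts -> Prop with
  | [::] => fun _ _ _ => True
  | Arr ds :: ts' => fun X F G =>
      (forall xi : args ds, X.1 xi ->
         papp (A := nat) (ts := ds) F.1 xi = papp (A := nat) (ts := ds) G.1 xi) /\
      agree_on (ts := ts') X.2 F.2 G.2
  end.

(* An argument of type 0 is the case ds = [::], where a tuple set is a subset of
   unit. *)
Definition countably_based (ts : seq ftype) (Phi : part ts) : Prop :=
  forall (F : args ts) (y : nat), papp Phi F = Some y ->
  exists X : bases ts, countable_bases X /\
    forall (G : args ts) (z : nat), papp Phi G = Some z ->
      agree_on X F G -> y = z.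

(** * Sets of reals and Cantor intersection functionals *)

(* Every rational is (a - b) / (c + 1) for some naturals a, b, c. *)
Definition rat_of_code (k : nat) : rat :=
  match CodeSeq.decode k with
  | [:: a; b; c] => ((a%:R - b%:R) / c.+1%:R)%R
  | _ => 0%R
  end.

(* Reals are coded by fast-converging Cauchy sequences of rationals. *)
Definition codes_real (R : realType) (f : nat -> nat) (x : R) : Prop :=
  (forall n i : nat,
     `|rat_of_code (f n) - rat_of_code (f (n + i))| < 2%:R ^- n)%R /\
  (ratr (rat_of_code (f n)) @[n --> \oo] --> x)%classic.

(* F is a characteristic function of C; as for any functional on the reals,
   its values at sequences that do not code a real are irrelevant. *)
Definition char_real (R : realType) (C : set R) (F : tot ty2) : Prop :=
  forall (f : nat -> nat) (x : R), codes_real f x ->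
    F f = if `[< C x >] then 1 else 0.

(* Arguments of a functional from sequences of subsets of [0,1] to [0,1]: the
   sequence n, f |-> F n f of characteristic functions, and the position k in
   the Cauchy sequence that is the output. *)
Definition cantor_dom : seq ftype := [:: Arr [:: ty0; ty1]; ty0].

(* The real x depends on the sets C n only, not on the choice of their
   characteristic functions. *)
Definition cantor_intersection_functional (R : realType) (Phi : part cantor_dom) : Prop :=
  forall C : nat -> set R,
    (forall n, [/\ closed (C n), (C n !=set0)%classic,
                   (C n.+1 `<=` C n)%classic & (C n `<=` `[0%R, 1%R])%classic]) ->
  exists2 x : R, (\bigcap_n C n)%classic x &
    forall F : nat -> (nat -> nat) -> nat, (forall n, char_real (C n) (F n)) ->
    exists2 f : nat -> nat, codes_real f x & forall k, Phi F k = Some (f k).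

(** * The functional Omega_C *)

Definition seq_of_cantor (b : cantor_space) : nat -> nat := fun n => nat_of_bool (b n).

(* Omega_C, as a functional of the characteristic function F of a subset of
   Cantor space. *)
Definition Omega_C : part [:: ty2] :=
  fun F : (nat -> nat) -> nat =>
    let X : set cantor_space := [set b | F (seq_of_cantor b) = 1]%classic in
    if `[< (forall b, F (seq_of_cantor b) = 0 \/ F (seq_of_cantor b) = 1) /\
           closed X >]
    then Some (if `[< X = set0 >] then 0 else 1)
    else None.

(** * The continuum hypothesis *)

Definition CH : Prop :=
  forall A : set (nat -> bool), countable A \/ (A #= [set: nat -> bool])%card.

(* Main.v *)
Require Import Defs.
From mathcomp Require Import all_boot all_order all_algebra.
From mathcomp Require Import all_classical all_reals all_analysis.
From mathcomp Require Import wochoice.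
From Stdlib Require Import Eqdep.
From Stdlib Require List.

(* Under CH the reals carry a well-order all of whose initial segments are
   countable.  Phi0 returns the least element x of the intersection of the C n:
   that x is least is settled by the values of the characteristic functions at
   the countably many y <= x, so Phi0 is countably based.

   By induction on S1-S9, the value of a computation relative to countably
   based functionals depends on countably many values of a given input F of
   type 2, among the G for which it converges.  Applied to the empty subset F
   of Cantor space and an index of Omega_C, this yields a countable set of
   sequences; if b lies outside it, the computation gives the same value for
   {b} as for the empty set. *)

Set Implicit Arguments.
Unset Strict Implicit.
Unset Printing Implicit Defensive.
Import Order.TTheory GRing.Theory Num.Theory.
Import numFieldNormedType.Exports.
Local Open Scope classical_set_scope.

(** * Well-orders with countable initial segments *)

Definition omega1_like (T : Type) (le : T -> T -> Prop) :=
  [/\ forall D : set T, D !=set0 -> exists2 x, D x & forall y, D y -> le x y,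
      forall x y, le x y -> le y x -> x = y &
      forall x, countable [set y | le y x]].

Lemma countable_preimage (T U : Type) (f : T -> U) (A : set U) :
  injective f -> countable A -> countable (f @^-1` A).
Proof. by move=> fI; apply/sub_countable/card_ge_preimage => x y _ _ /fI. Qed.

Lemma countableU T (X Y : set T) : countable X -> countable Y -> countable (X `|` Y).
Proof.
move=> cX cY; rewrite -bigcup2E; apply: bigcup_countable => // i _.
by case: i => [|[|i]].
Qed.

(** Countability is asked only of segments below points of the image of [f]: the order [R] may have
    uncountable segments elsewhere. *)
Lemma omega1_like_inj (T U : Type) (f : T -> U) (R : U -> U -> Prop) :
  injective f ->
  (forall D : set U, D !=set0 -> exists2 x, D x & forall y, D y -> R x y) ->
  (forall x y, R x y -> R y x -> x = y) ->
  (forall x, countable [set y | R y (f x)]) ->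
  omega1_like (fun x y => R (f x) (f y)).
Proof.
move=> fI Rwf Ranti cR; split.
- move=> D [x0 Dx0]; have [|_ [x Dx <-] xmin] := Rwf (f @` D).
    by exists (f x0), x0.
  by exists x => // y Dy; apply: xmin; exists y.
- by move=> x y xy yx; apply/fI/Ranti.
- by move=> x; exact: (@countable_preimage _ _ f [set y | R y (f x)]).
Qed.

(* If some initial segment of a well-order on 2^N is uncountable, the least such
   segment is equinumerous with 2^N by CH, and its order is transported. *)
Lemma CH_omega1_like (T : Type) (i : T -> nat -> bool) :
  CH -> injective i -> exists le, @omega1_like T le.
Proof.
move=> ch iI; have [R Rwo] := well_ordering_principle (nat -> bool).
have Rwf (D : set (nat -> bool)) : D !=set0 -> exists2 x, D x & forall y, D y -> R x y.
  move=> [x0 Dx0]; have [|x [[xD xmin] _]] := Rwo (mem D).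
    by exists x0; apply/asboolP.
  by exists x; [exact/asboolP|move=> y Dy; apply: xmin; exact/asboolP].
have Rwc : wo_chain R predT by move=> A _; exact: Rwo.
have Ranti x y : R x y -> R y x -> x = y.
  by move=> xy yx; apply: (wo_chain_antisymmetric Rwc) => //; rewrite xy.
suff [j jI cj] : exists2 j : (nat -> bool) -> (nat -> bool), injective j &
    forall x, countable [set y | R y (j x)].
  exists (fun x y => R (j (i x)) (j (i y))).
  apply: (@omega1_like_inj _ _ (j \o i) R) => //; first exact: inj_comp.
  by move=> x; exact: cj.
have [cR|] := pselect (forall x, countable [set y | R y x]); first by exists id.
move=> /existsNP R_unc.
have [a a_unc amin] := Rwf [set x | ~ countable [set y | R y x]] R_unc.
(* The point [a] is left out so that every point of [S] lies strictly below [a] and has a countable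
   segment, by minimality of [a]. *)
pose S := [set y | R y a /\ y <> a].
have S_unc : ~ countable S.
  move=> cS; apply: a_unc; apply: (@sub_countable _ _ _ (S `|` [set a])).
    apply: subset_card_le => y /= Rya.
    by have [->|ya] := pselect (y = a); [right|left].
  exact: countableU.
have [//|/card_esym] := ch S.
move=> /card_set_bijP[j [jS /in2TT jI _]]; exists j => // x.
apply: contrapT => /amin Raj; have [Rja] := jS x I.
by apply; exact: Ranti.
Qed.

(** * Codes of reals *)

Section Reals.
Variable R : realType.
Local Open Scope ring_scope.

Lemma rat_of_code_surj (q : rat) : exists k, rat_of_code k = q.
Proof.
have [c cE] : exists c, denq q = c.+1%:Z.
  by have := denq_gt0 q; case: (denq q) => // -[//|c] _; exists c.
have [[a b] abE] : exists ab : nat * nat, numq q = ab.1%:Z - ab.2%:Z.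
  case: (numq q) => n; first by exists (n, 0%N); rewrite subr0.
  by exists (0%N, n.+1); rewrite sub0r NegzE.
exists (CodeSeq.code [:: a; b; c]).
by rewrite /rat_of_code CodeSeq.codeK -[RHS]divq_num_den abE cE rmorphB.
Qed.

Lemma rat_of_code_dense (x y : R) : x < y ->
  exists k, x < ratr (rat_of_code k) < y.
Proof.
move=> /rat_in_itvoo[q]; rewrite in_itv /=.
by have [k <-] := rat_of_code_surj q; exists k.
Qed.

Definition lower_cut (x : R) (k : nat) : bool := ratr (rat_of_code k) < x.

(** Rational cuts embed the reals into 2^N, the set about which [CH] speaks; a rational strictly
    between two reals separates their cuts. *)
Lemma lower_cut_inj : injective lower_cut.
Proof.
have lt_neq x y : x < y -> lower_cut x <> lower_cut y.
  move=> /rat_of_code_dense[k /andP[xk ky]] /(congr1 (@^~ k)).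
  by rewrite /lower_cut ky lt_gtF.
move=> x y xy; have [/lt_neq|/lt_neq/nesym|//] := ltgtP x y; by case.
Qed.

Lemma codes_real_exists (x : R) : exists f, codes_real f x.
Proof.
(* An error below 2^-(n+1) at position n leaves room for two such errors in the required bound
   2^-n. *)
have /choice[f fP] : forall n : nat, exists k,
    `|ratr (rat_of_code k) - x| < 2%:R ^- n.+1 :> R.
  move=> n; have [|k /andP[k1 k2]] := @rat_of_code_dense x (x + 2%:R ^- n.+1).
    by rewrite ltrDl invr_gt0 exprn_gt0.
  exists k; rewrite ltr_distl k2 andbT; apply: le_lt_trans k1.
  by rewrite gerBl invr_ge0 exprn_ge0.
exists f; split=> [n i|].
  rewrite -(ltr_rat R) ratr_norm rmorphB /= fmorphV rmorphXn /= ratr_nat.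
  rewrite -(subrKA x) (le_lt_trans (ler_normD _ _)) // [`|x - _|]distrC.
  rewrite (lt_le_trans (ltrD (fP _) (fP _))) //.
  have h m : 2%:R ^- m.+1 + 2%:R ^- m.+1 = 2%:R ^- m :> R.
    rewrite exprS invfM -mulrDl -[RHS]mul1r; congr (_ * _).
    by rewrite [RHS]splitr !mul1r.
  rewrite -[leRHS]h lerD2l lef_pV2 ?posrE ?exprn_gt0 //.
  by rewrite ler_eXn2l ?ltr1n // ltnS leq_addr.
apply/cvgrPdist_lt => e e0.
apply: filterS (near_infty_natSinv_expn_lt (PosNum e0)) => n /= ne.
rewrite distrC (lt_trans (fP n)) // (le_lt_trans _ ne) // div1r.
by rewrite lef_pV2 ?posrE ?exprn_gt0 // ler_eXn2l ?ltr1n.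
Qed.

(** Points chosen from the [C n] have a cluster point in the compact interval [0,1]; it lies in each
    [C n], which is closed and contains a tail of the sequence. *)
Lemma nested_closed_nonempty (C : nat -> set R) :
  (forall n, [/\ closed (C n), C n !=set0, C n.+1 `<=` C n & C n `<=` `[0, 1]]) ->
  \bigcap_n C n !=set0.
Proof.
move=> CP.
have /choice[u uC] : forall n, exists x, C n x by move=> n; have [] := CP n.
have Cle m n : (m <= n)%N -> C n `<=` C m.
  move=> /subnK <-; elim: (n - m)%N => // k IH.
  by have [_ _ s _] := CP (k + m)%N; apply: subset_trans s IH.
have uE n : (u @ \oo) (C n) by exists n => // m /= nm; exact: Cle (uC m).
have u01 : (u @ \oo) `[0%R, 1%R]%classic by apply: filterS (uE 0%N); have [] := CP 0%N.
have [x [_ xu]] := @segment_compact R 0 1 (u @ \oo) _ u01.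
exists x => n _; have [cC _ _ _] := CP n.
by apply: cC => B nB; exact: xu.
Qed.

End Reals.

(** * The functional Phi0 *)

Fixpoint rank_le (n : nat) (s : ftype) : bool :=
  match n, s with
  | 0, Arr ts => nilp ts
  | n'.+1, Arr ts => all (rank_le n') ts
  end.

Lemma countable_args (us : seq ftype) :
  all (rank_le 0) us -> countable [set: args us].
Proof.
elim: us => [_|[us] us' IH /= /andP[/nilP -> /IH{}IH]].
  by apply/countable_injP; exists (fun=> 0) => [] [] [].
have := @countableX _ _ [set: nat] [set: args us'] (countableP _) IH.
by apply: sub_countable; apply: subset_card_le.
Qed.

Section Functional.
Variables (R : realType) (code : R -> nat -> nat) (le : R -> R -> Prop).
Hypothesis codeP : forall x, codes_real (code x) x.
Hypothesis leP : omega1_like le.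

(** Each real is tested at one chosen code. Characteristic functions give the same answer at every
    code, and for arbitrary [F] the relevant queries are then indexed by pairs of a number and a
    real. *)
Definition members (F : nat -> (nat -> nat) -> nat) : set R :=
  [set y | forall n, F n (code y) = 1].

Definition least_member (F : nat -> (nat -> nat) -> nat) (x : R) :=
  members F x /\ forall y, members F y -> le x y.

Definition least_functional : part cantor_dom := fun F k =>
  if pselect (exists x, least_member F x) is left ex
  then Some (code (projT1 (cid ex)) k) else None.

Lemma least_member_uniq F x y : least_member F x -> least_member F y -> x = y.
Proof.
by have [_ le_anti _] := leP; move=> [Fx xmin] [Fy ymin]; apply: le_anti; auto.
Qed.

Lemma least_functionalE F k y : least_functional F k = Some y ->
  exists2 x, least_member F x & y = code x k.
Proof.
rewrite /least_functional; case: pselect => // ex [<-].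
by case: (cid ex) => x; exists x.
Qed.

Lemma least_functional_least F x k :
  least_member F x -> least_functional F k = Some (code x k).
Proof.
move=> xF; rewrite /least_functional; case: pselect => [ex|]; last by case; exists x.
by case: (cid ex) => x' /= x'F; rewrite (least_member_uniq xF x'F).
Qed.

Lemma le_total x y : le x y \/ le y x.
Proof.
have [le_min _ _] := leP.
have [|z [->|->] zmin] := le_min [set x; y]; first by exists x; left.
  by left; apply: zmin; right.
by right; apply: zmin; left.
Qed.

Lemma least_functional_cantor : cantor_intersection_functional R least_functional.
Proof.
have [le_min _ _] := leP.
move=> C /nested_closed_nonempty/le_min[x Cx xmin]; exists x => // F FC.
have memE y : members F y <-> (\bigcap_n C n) y.
  split=> [Fy n _|Cy n].
    by move: (Fy n); rewrite (FC _ _ _ (codeP y)); case: asboolP.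
  by rewrite (FC _ _ _ (codeP y)); case: asboolP => // -[]; exact: Cy.
exists (code x) => // k; apply: least_functional_least.
by split=> [|y /memE]; [exact/memE|exact: xmin].
Qed.

Lemma least_functional_countably_based : countably_based least_functional.
Proof.
have [_ le_anti le_count] := leP.
move=> [F [k []]] y /= /least_functionalE[x [Fx xmin] ->].
pose q (p : nat * R) : args [:: ty0; ty1] := (p.1, (code p.2, tt)).
exists (q @` (setT `*` [set z | le z x]), (setT, tt)); split=> /=.
  split; last by split=> //; exact: (@countable_args [::]).
  by apply: (sub_countable (card_image_le _ _)); exact: countableX.
move=> [G [l []]] z /= /least_functionalE[x' [Gx' x'min] ->] [FG [kl _]].
rewrite -(kl tt) //; suff -> : x = x' by [].
have FGE n w : le w x -> F n (code w) = G n (code w).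
  by move=> wx; apply: (FG (q (n, w))); exists (n, w).
have le_xx : le x x by case: (le_total x x).
(* Agreement below [x] makes [x] a member for [G], so [x'] is below [x]; then agreement at [x']
   makes it a member for [F], and minimality of [x] gives the converse. *)
have x'x : le x' x by apply: x'min => n; rewrite -FGE.
by apply: le_anti => //; apply: xmin => n; rewrite FGE.
Qed.

End Functional.

(** * Computations depend on countably many values *)

Lemma papp_inj (A : Type) (ts : seq ftype) (F G : funs A ts) :
  (forall x, papp F x = papp G x) -> F = G.
Proof.
elim: ts F G => [|t ts IH] /= F G FG; first exact: (FG tt).
by apply/funext => x; apply: IH => y; exact: (FG (x, y)).
Qed.

(** Argument tuples of an object of rank at most 1 consist of numbers, so the set of all of them is
    already countable. *)
Lemma exists_separating_bases (ts : seq ftype) : all (rank_le 1) ts ->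
  exists2 B : bases ts, countable_bases B &
    forall F G : args ts, agree_on B F G -> F = G.
Proof.
elim: ts => [_|[us] ts IH /= /andP[us0 /IH[B cB BP]]].
  by exists tt => // [] [] [].
exists (setT, B); first by split => //; exact: countable_args.
move=> [F F'] [G G'] /= [FG /BP ->]; congr pair.
by apply: (@papp_inj nat us) => x; exact: FG.
Qed.

Lemma countably_based_rank1 (ts : seq ftype) (Phi : part ts) :
  all (rank_le 1) ts -> countably_based Phi.
Proof.
move=> /exists_separating_bases[B cB BP] F y Fy.
by exists B; split=> // G z Gz /BP FG; move: Fy; rewrite FG Gz => -[].
Qed.

(* The rank bound makes the arguments xi of the objects lambda xi. {d}(xi, phi, b)
   in S8 have rank at most 1, so that they are tame again. *)
Definition tame (a : input) : Prop :=
  countably_based (input_val a) /\ all (rank_le 2) (input_dom a).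

Definition all_tame (b : seq input) := List.Forall tame b.

Lemma rank_leW n s : rank_le n s -> rank_le n.+1 s.
Proof.
elim: n s => [|n IH] [ts] /=; first by move=> /nilP ->.
by apply: sub_all => t; exact: IH.
Qed.

Lemma tame_total_input (t : ftype) (F : tot t) :
  rank_le 2 t -> tame (total_input F).
Proof.
case: t F => ts F ts1; split; first exact: countably_based_rank1.
exact: (@rank_leW 2 (Arr ts)).
Qed.

Lemma tame_num n : tame (num_input n).
Proof. exact: (@tame_total_input (Arr [::])). Qed.

Lemma all_tame_inputs (us : seq ftype) (xi : args us) :
  all (rank_le 1) us -> all_tame (inputs xi).
Proof.
elim: us xi => [|u us IH] /= xi; first by constructor.
move=> /andP[u1 us1]; constructor; last exact: IH.
by apply: tame_total_input; exact: rank_leW.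
Qed.

(** * Replacing one input of type 2 by another *)

Section Replace.
Variables F G : tot ty2.

(** Keeping an entry is always allowed, even one equal to [total_input F], so that other inputs can
    be carried along unchanged. *)
Definition repl (a a' : input) : Prop :=
  a = a' \/ a = total_input F /\ a' = total_input G.

Lemma repl_refl b : List.Forall2 repl b b.
Proof. by elim: b => [|a b IH]; constructor => //; left. Qed.

Lemma repl_num n a : repl (num_input n) a -> a = num_input n.
Proof. by case=> [<- //|[/(congr1 input_dom)]]. Qed.

Lemma Forall2_cat1 b c b' : List.Forall2 repl (b ++ c) b' ->
  exists b1 c1, [/\ b' = b1 ++ c1, List.Forall2 repl b b1 & List.Forall2 repl c c1].
Proof. by move=> /List.Forall2_app_inv_l[b1 [c1 [? []]]]; exists b1, c1. Qed.

Lemma Forall2_cons1 a c b' : List.Forall2 repl (a :: c) b' ->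
  exists a1 c1, [/\ b' = a1 :: c1, repl a a1 & List.Forall2 repl c c1].
Proof. by move=> h; inversion h; subst; do 2 eexists; split. Qed.

Lemma Forall2_size b b' : List.Forall2 repl b b' -> size b = size b'.
Proof. exact: List.Forall2_length. Qed.

End Replace.

Definition agree (X : set (nat -> nat)) (F G : tot ty2) :=
  forall f, X f -> F f = G f.

Lemma agreeU X Y F G : agree (X `|` Y) F G -> agree X F G /\ agree Y F G.
Proof. by move=> h; split=> f Xf; apply: h; [left|right]. Qed.

Section Determined.
Variable F : tot ty2.

(** As in [countably_based], convergence at the modified inputs is a premise; it is not claimed to
    carry over from [b] to [b']. *)
Definition determined (e : nat) (b : seq input) (y : nat) : Prop :=
  all_tame b -> exists2 X, countable X &
    forall G b' z, agree X F G -> List.Forall2 (repl F G) b b' ->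
      kleene e b' z -> y = z.

(** An object lambda xi. {d}(xi, b) can have uncountably many values, each with its own countable
    set, so agreement is secured only on a countable [B] fixed beforehand. *)
Definition determined_args (ts : seq ftype) (ds : seq nat) (b : seq input)
    (H : args ts) : Prop :=
  all_tame b -> all (rank_le 2) ts -> forall B : bases ts, countable_bases B ->
  exists2 X, countable X &
    forall G b' H', agree X F G -> List.Forall2 (repl F G) b b' ->
      kleene_args ds b' H' -> agree_on B H H'.

End Determined.

(** * Inversion of computations *)

Lemma num_input_inj : injective num_input.
Proof.
pose v a := match a with @Inp [::] o => o | _ => None end.
by move=> m n /(congr1 v)[].
Qed.

Lemma cons_inj (T : Type) (a a' : T) b b' : a :: b = a' :: b' -> a = a' /\ b = b'.
Proof. by move=> [-> ->]. Qed.

Lemma num_cons_inj m n b c :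
  num_input m :: b = num_input n :: c -> m = n /\ b = c.
Proof. by move=> E; have [/num_input_inj -> ->] := cons_inj E. Qed.

Lemma Inp_inj ts (f g : part ts) : Inp f = Inp g -> f = g.
Proof.
pose t a := existT part (input_dom a) (input_val a).
by move=> E; exact: inj_pairT2 (congr1 t E).
Qed.

(** Indices are numbers computed by [idx], so the clauses are told apart by decoding the index
    rather than by unification. *)
Lemma kleene_inv e b y : kleene e b y ->
  match CodeSeq.decode e with
  | [:: 1] => exists x c, b = num_input x :: c /\ y = x.+1
  | [:: 2; q] => y = q
  | [:: 3] => exists c, b = num_input y :: c
  | [:: 4; g; h] => exists2 x, kleene h b x & kleene g (num_input x :: b) y
  | [:: 5; g; h] => exists n c, b = num_input n :: c /\
     match n with
     | 0 => kleene g c y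
     | n.+1 => exists2 z, kleene e (num_input n :: c) z &
                 kleene h (num_input n :: num_input z :: c) y
     end
  | [:: 6; k; g] => exists b1 a c, [/\ b = b1 ++ a :: c, size b1 = k &
        kleene g (a :: b1 ++ c) y]
  | [:: 7] => exists (f : part [:: ty0]) x c,
       b = Inp f :: num_input x :: c /\ f x = Some y
  | 8 :: ds => exists ts (phi : part ts) c H, [/\ b = Inp phi :: c,
      kleene_args ds b H & papp phi H = Some y]
  | [:: 9; m] => exists e' b1 c, [/\ b = num_input e' :: b1 ++ c, size b1 = m &
      kleene e' b1 y]
  | _ => False
  end.
Proof.
case; intros; rewrite CodeSeq.codeK //; repeat eexists; eauto.
Qed.

Lemma kleene_args_inv ts ds b (H : args ts) : kleene_args ds b H ->
  match ts, ds return args ts -> Prop with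
  | Arr us :: ts', d :: ds' => fun H =>
      (forall xi : args us,
        kleene d (inputs xi ++ b) (papp (A := nat) (ts := us) H.1 xi)) /\
      kleene_args ds' b H.2
  | _, _ => fun=> True
  end H.
Proof. by case. Qed.

Scheme kleene_mut := Minimality for kleene Sort Prop
with kleene_args_mut := Minimality for kleene_args Sort Prop.

Lemma kleene_determined F e b y : kleene e b y -> determined F e b y.
Proof.
apply: (@kleene_mut (determined F) (@determined_args F)) => {e b y}.
- move=> x b _; exists set0 => // G _ z _ /Forall2_cons1[_ [c [-> /repl_num-> _]]].
  by move=> /kleene_inv; rewrite CodeSeq.codeK => -[u [v [E ->]]]; have [->] := num_cons_inj E.
- move=> q b _; exists set0 => // G b' z _ _ /kleene_inv.
  by rewrite CodeSeq.codeK.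
- move=> x b _; exists set0 => // G _ z _ /Forall2_cons1[_ [c [-> /repl_num-> _]]].
  by move=> /kleene_inv; rewrite CodeSeq.codeK => -[v E]; have [->] := num_cons_inj E.
- move=> g h b x y _ IHh _ IHg gb.
  have [X cX XP] := IHh gb.
  have [Y cY YP] := IHg (List.Forall_cons _ (tame_num x) gb).
  exists (X `|` Y); first exact: countableU.
  move=> G b' z /agreeU[aX aY] bb' /kleene_inv; rewrite CodeSeq.codeK => -[x' hx' gz].
  (* The intermediate values coincide, so the second computations run on inputs related by
     [repl]. *)
  move: gz; rewrite -(XP _ _ _ aX bb' hx') => gz.
  apply: (YP _ _ _ aY _ gz); constructor=> //; by left.
- move=> g h b y _ IH gb.
  have [X cX XP] := IH (List.Forall_inv_tail gb); exists X => //.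
  move=> G _ z aX /Forall2_cons1[_ [c [-> /repl_num-> bc]]].
  move=> /kleene_inv; rewrite CodeSeq.codeK => -[n [v [E gz]]]; have [n0 ?] := num_cons_inj E.
  move: gz; subst.
  exact: (XP _ _ _ aX bc).
- move=> g h n b z y _ IHr _ IHh gb.
  have gb' := List.Forall_inv_tail gb.
  have [X cX XP] := IHr (List.Forall_cons _ (tame_num n) gb').
  have [Y cY YP] := IHh (List.Forall_cons _ (tame_num n)
                          (List.Forall_cons _ (tame_num z) gb')).
  exists (X `|` Y); first exact: countableU.
  move=> G _ y' /agreeU[aX aY] /Forall2_cons1[_ [c [-> /repl_num-> bc]]].
  move=> /kleene_inv; rewrite CodeSeq.codeK.
  move=> [m [v [E]]]; have [<- <-] := num_cons_inj E => -[z' rz' hy'].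
  have ? : z = z' by apply: (XP _ _ _ aX _ rz'); constructor => //; left.
  subst z'; apply: (YP _ _ _ aY _ hy').
  by constructor; [left|constructor; [left|]].
- move=> k g a b c y sb _ IH gb.
  have /List.Forall_app[gb1 gac] := gb.
  have gabc : all_tame (a :: b ++ c).
    constructor; first exact: List.Forall_inv gac.
    by apply/List.Forall_app; split => //; exact: List.Forall_inv_tail gac.
  have [X cX XP] := IH gabc; exists X => //.
  move=> G _ z aX /Forall2_cat1[b1 [_ [-> bb1 /Forall2_cons1[a1 [c1 [-> aa1 cc1]]]]]].
  move=> /kleene_inv; rewrite CodeSeq.codeK => -[b2 [a2 [c2 [E s2 gz]]]].
  (* Inversion yields some splitting of the inputs; the length stored in the index forces it to be
     the one at hand. *)
  have sE : size b1 = size b2 by rewrite -(Forall2_size bb1) sb s2.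
  move: (E) => /(congr1 (take (size b1))).
  rewrite take_size_cat // sE take_size_cat // => ?; subst b2.
  move/(congr1 (drop (size b1))): E; rewrite !drop_size_cat // => -[? ?]; subst.
  apply: (XP _ _ _ aX _ gz); constructor => //; exact: List.Forall2_app.
(* S7 only applies inputs of type 1; these differ in type from [F], so no value of [F] is
   consulted. *)
- move=> f x b y fx gb; exists set0 => //.
  move=> G _ z _ /Forall2_cons1[f1 [_ [-> ff1 /Forall2_cons1[_ [c [-> /repl_num-> _]]]]]].
  move=> /kleene_inv; rewrite CodeSeq.codeK => -[f2 [x2 [c2 [E]]]].
  have [Ef /num_cons_inj[? _]] := cons_inj E.
  subst; case: ff1 => [Ef|[/(congr1 input_dom)//]]; rewrite -(Inp_inj Ef).
  by rewrite fx => -[].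
- move=> ts phi ds b H y _ IH Hy gb.
  have [cphi rphi] := List.Forall_inv gb.
  (* When all argument types have rank at most 1, as they do if [phi] is [F], the basis is taken
     large enough to determine the arguments; otherwise the basis of [phi] at [H] is used. *)
  have [B cB [BP BS]] : exists2 B : bases ts, countable_bases B &
      (forall H' z, papp phi H' = Some z -> agree_on B H H' -> y = z) /\
      (all (rank_le 1) ts -> forall H', agree_on B H H' -> H = H').
    have [/exists_separating_bases[B cB BP]|ts1] := boolP (all (rank_le 1) ts).
      exists B => //; split=> [H' z H'z /BP HH'|_ H' /BP //].
      by move: Hy; rewrite HH' H'z => -[].
    by have [B [cB BP]] := cphi _ _ Hy; exists B.
  have [X cX XP] := IH gb rphi _ cB.
  (* If phi is F, the value also depends on F at the argument of this call:
     [Y] consists of that argument, and is empty for other shapes of [ts]. *)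
  pose Y : set (nat -> nat) :=
    [set f | existT args ts H = existT args [:: ty1] (f, tt)].
  have cY : countable Y.
    apply/countable_injP; exists (fun=> 0) => f g; rewrite !inE => Yf Yg _.
    have E : existT args [:: ty1] (f, tt) = existT args [:: ty1] (g, tt).
      by rewrite -Yf.
    by have [] := inj_pairT2 _ _ _ _ _ E.
  exists (X `|` Y); first exact: countableU.
  move=> G _ z /agreeU[aX aY] /Forall2_cons1[a [c [-> pa bc]]].
  move=> /kleene_inv; rewrite CodeSeq.codeK => -[ts' [phi' [c' [H' [E k Hz]]]]].
  have [? ?] := cons_inj E; subst a c'.
  have ? : ts = ts'.
    by case: pa => [/(congr1 input_dom)//|[/(congr1 input_dom)/= -> /(congr1 input_dom)/= ->]].
  subst ts'.
  have HH' : agree_on B H H' by apply: (XP _ _ _ aX _ k); constructor.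
  case: pa => [Ephi|[EF EG]].
    by apply: BP HH'; rewrite (Inp_inj Ephi).
  (* Here [phi] is [F] and was replaced by [G]: both are applied to the same argument, at which they
     agree by the choice of [Y]. *)
  have ? : ts = [:: ty1] := congr1 input_dom EF.
  subst ts; have ? := BS isT _ HH'; subst H'.
  move: Hy Hz; rewrite (Inp_inj EF) (Inp_inj EG).
  case: H @Y cY aY {IH k XP BP BS HH'} => f [] Y cY aY /= [<-] [<-].
  by apply: aY.
- move=> m e b c y sb _ IH gb.
  have /List.Forall_app[gb1 _] := List.Forall_inv_tail gb.
  have [X cX XP] := IH gb1; exists X => //.
  move=> G _ z aX /Forall2_cons1[_ [_ [-> /repl_num-> /Forall2_cat1[b1 [c1 [-> bb1 _]]]]]].
  move=> /kleene_inv; rewrite CodeSeq.codeK => -[e' [b2 [c2 [E' s2]]]].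
  have [<- E] := num_cons_inj E'.
  move/(congr1 (take (size b1))): E; rewrite take_size_cat //.
  rewrite -(Forall2_size bb1) sb -s2 take_size_cat // => <-.
  by move=> k; exact: (XP _ _ _ aX bb1 k).
- by move=> b _ _ [] _; exists set0.
- move=> us ts d ds b H H2 _ IH1 _ IH2 gb /= /andP[us1 ts2] [B1 B2] /= [cB1 cB2].
  have [X2 cX2 X2P] := IH2 gb ts2 _ cB2.
  have /choice[X1 X1P] : forall xi : args us, exists X, countable X /\
      forall G b' z, agree X F G -> List.Forall2 (repl F G) b b' ->
        kleene d (inputs xi ++ b') z -> papp (A := nat) (ts := us) H xi = z.
    move=> xi.
    have [|X cX XP] := IH1 xi.
      by apply/List.Forall_app; split => //; exact: all_tame_inputs.
    exists X; split => // G b' z aX bb'; apply: (XP _ _ _ aX).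
    by apply: List.Forall2_app => //; exact: repl_refl.
  (* Only the xi in the countable set [B1] contribute, so the union remains countable. *)
  exists ((\bigcup_(xi in B1) X1 xi) `|` X2).
    by apply: countableU => //; apply: bigcup_countable => // xi _; have [] := X1P xi.
  move=> G b' [H' H2'] /agreeU[a1 a2] bb' /kleene_args_inv/= [k1 k2]; split.
    move=> xi B1xi; have [_ XP] := X1P xi; apply: XP bb' (k1 xi).
    by move=> f Xf; apply: a1; exists xi.
  exact: X2P bb' k2.
Qed.

(** * Omega_C *)

Lemma seq_of_cantor_inj : injective seq_of_cantor.
Proof.
move=> b c bc; apply/funext => n.
by have := congr1 (@^~ n) bc; rewrite /seq_of_cantor; case: (b n); case: (c n).
Qed.

(** Diagonalisation: if [f] numbered all of Cantor space injectively, the point [d] would differ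
    from each point c at the position that [f] assigns to c, hence from itself. *)
Lemma countable_avoid_cantor (X : set (nat -> nat)) :
  countable X -> exists b, ~ X (seq_of_cantor b).
Proof.
move=> /countable_injP[f fI]; apply: contrapT => /forallNP XT.
have {}XT b : seq_of_cantor b \in X.
  by apply/mem_set; apply: contrapT; exact: XT.
pose d : cantor_space := fun n => `[< exists2 c, f (seq_of_cantor c) = n & c n = false >].
have dP : ~ d (f (seq_of_cantor d)).
  move=> dd; have /asboolP[c cd cF] := dd; move: cF.
  by rewrite (seq_of_cantor_inj (fI _ _ (XT c) (XT d) cd)) dd.
apply: (dP); apply/asboolP; exists d => //; exact/negbTE/negP.
Qed.

Lemma Omega_C_not_computed (os : seq input) :
  all_tame os -> ~ computes os Omega_C.
Proof.
move=> gos [e eP].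
pose F0 : tot ty2 := fun=> 0.
have O0 : Omega_C F0 = Some 0.
  rewrite /Omega_C; have -> : [set b | F0 (seq_of_cantor b) = 1] = set0.
    by apply/seteqP; split.
  rewrite (asboolT (erefl _)); case: asboolP => // -[].
  by split=> [b|]; [left|exact: closed0].
have [||X cX XP] := @kleene_determined F0 e (total_input F0 :: os) 0.
- exact: (eP (F0, tt)).
- by constructor => //; exact: tame_total_input.
have [b Xb] := countable_avoid_cantor cX.
pose G : tot ty2 := fun f => if `[< f = seq_of_cantor b >] then 1 else 0.
have GE c : G (seq_of_cantor c) = 1 <-> c = b.
  rewrite /G; case: asboolP => [/seq_of_cantor_inj -> //|cb].
  by split=> // cE; case: cb; rewrite cE.
have OG : Omega_C G = Some 1.
  rewrite /Omega_C; have -> : [set c | G (seq_of_cantor c) = 1] = [set b].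
    by apply/seteqP; split=> c /= /GE.
  rewrite (@asboolF ([set b] = set0)); last by move=> /seteqP[/(_ b erefl)].
  case: asboolP => // -[]; split=> [c|].
    by rewrite /G; case: asboolP; [right|left].
  exact: (accessible_closed_set1 (hausdorff_accessible cantor_space_hausdorff)).
have eG : kleene e (total_input G :: os) 1 by exact: (eP (G, tt)).
suff: 0 = 1 by []; apply: (XP G _ _ _ _ eG).
  by move=> f Xf; rewrite /G /= asboolF // => fb; apply: Xb; rewrite -fb.
by constructor; [right|exact: repl_refl].
Qed.

Theorem theorem3p11 (R : realType) (ch : CH) :
  exists Phi0 : part cantor_dom,
    [/\ cantor_intersection_functional R Phi0,
        countably_based Phi0 &
        ~ computes [:: Inp Phi0; total_input (s := ty2) exists2_functional] Omega_C].
Proof.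
have [code codeP] := choice (@codes_real_exists R).
have [le leP] := CH_omega1_like ch (@lower_cut_inj R).
have cb := @least_functional_countably_based R code le leP.
exists (least_functional code le); split => //.
  exact: least_functional_cantor.
apply: Omega_C_not_computed; constructor; first by split.
by constructor; [exact: tame_total_input|constructor].
Qed.
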